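(* Let $T$ and $T'$ be reduced linear trellises of the same length. If $T$ and $T'$ are isomorphic, then they are linearly isomorphic. Equivalently: if the vertex sets of a reduced trellis $T$ carry two vector space structures each of which makes $T$ linear, the two resulting linear trellises are linearly isomorphic.
   Context: Let $\mathbb{F}$ be a finite field and $n\ge1$; indices are taken in $\mathbb{Z}_n$. A trellis $T$ of length $n$ over $\mathbb{F}$ consists of pairwise disjoint finite vertex sets $V_i(T)$, $i\in\mathbb{Z}_n$, and edge sets $E_i(T)\subseteq V_i(T)\times\mathbb{F}\times V_{i+1}(T)$; $(v,\alpha,w)\in E_i(T)$ is an edge from $v$ to $w$ with label $\alpha$. Trellises are trim (each vertex has an outgoing and an incoming edge). $T$ is linear if each $V_i(T)$ is an $\mathbb{F}$-vector space and each $E_i(T)$ is a subspace of $V_i(T)\times\mathbb{F}\times V_{i+1}(T)$. A cycle is a closed path of length $n$ starting in $V_0(T)$; $T$ is reduced if every edge lies on some cycle. An isomorphism $f:T\to T'$ of trellises of the same length is a family of bijections $f_i:V_i(T)\to V_i(T')$ with $(v,\alpha,w)\in E_i(T)\iff(f_i(v),\alpha,f_{i+1}(w))\in E_i(T')$ for all $i$; it is a linear isomorphism if $T,T'$ are linear and all $f_i$ are linear. *)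

(* Defs.v *)
From HB Require Import structures.
From mathcomp Require Import all_boot all_algebra.
Set Implicit Arguments. Unset Strict Implicit. Unset Printing Implicit Defensive.
Import GRing.Theory.
Local Open Scope ring_scope.

(* A trellis of length n over F: vertex sets V i (i : 'I_n, indices taken
   cyclically, successor = ordS i), finite; edges E i : V i -> F -> V (i+1).
   Pairwise disjointness of the V i is automatic (distinct index types).
   Linear trellises: each V i is a finite F-vector space (finLmodType F). *)

Section Trellis.
Variables (F : finFieldType) (n : nat).

Definition lin_edges (U W : lmodType F) (R : U -> F -> W -> Prop) : Prop :=
  R 0 0 0 /\
  forall (c : F) x a y x' a' y', R x a y -> R x' a' y' ->
    R (c *: x + x') (c * a + a') (c *: y + y').

Definition linear_trellis (V : 'I_n -> finLmodType F)
  (E : forall i : 'I_n, V i -> F -> V (ordS i) -> Prop) : Prop :=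
  forall i, lin_edges (E i).

Definition trim (V : 'I_n -> Type)
  (E : forall i : 'I_n, V i -> F -> V (ordS i) -> Prop) : Prop :=
  (forall i (v : V i), exists a w, E i v a w) /\
  (forall i (w : V (ordS i)), exists v a, E i v a w).

(* A cycle: vertices v i and labels a i with (v i, a i, v (i+1)) in E i for
   all i in Z_n (it is closed by construction, starting at v 0). *)
Definition is_cycle (V : 'I_n -> Type)
  (E : forall i : 'I_n, V i -> F -> V (ordS i) -> Prop)
  (v : forall i, V i) (a : 'I_n -> F) : Prop :=
  forall i, E i (v i) (a i) (v (ordS i)).

Definition reduced (V : 'I_n -> Type)
  (E : forall i : 'I_n, V i -> F -> V (ordS i) -> Prop) : Prop :=
  forall i x al y, E i x al y ->
    exists v a, is_cycle E v a /\ v i = x /\ a i = al /\ v (ordS i) = y.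

Definition trellis_iso (V W : 'I_n -> Type)
  (E : forall i : 'I_n, V i -> F -> V (ordS i) -> Prop)
  (E' : forall i : 'I_n, W i -> F -> W (ordS i) -> Prop)
  (f : forall i, V i -> W i) : Prop :=
  (forall i, bijective (f i)) /\
  (forall i x al y, E i x al y <-> E' i (f i x) al (f (ordS i) y)).

Definition linear_trellis_iso (V W : 'I_n -> finLmodType F)
  (E : forall i : 'I_n, V i -> F -> V (ordS i) -> Prop)
  (E' : forall i : 'I_n, W i -> F -> W (ordS i) -> Prop)
  (f : forall i, V i -> W i) : Prop :=
  trellis_iso E E' f /\
  (forall i (c : F) (x y : V i), f i (c *: x + y) = c *: f i x + f i y).

End Trellis.

(* Main.v *)
Require Import Defs.
From HB Require Import structures.
From mathcomp Require Import all_boot all_algebra.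
From mathcomp Require Import zify.
From Stdlib Require Import Classical ClassicalEpsilon.

(** A linear trellis is recovered from its space of cycles together with the
    labels and, for every position i, the subspace of cycles passing through 0
    there; that subspace is the case l = n of U(i, l), the cycles supported on
    the arc of l edges starting at i. List the arcs by increasing length.
    Cutting cycles at a zero vertex and closing the pieces by zeros shows that
    U(i, l) meets the sum of all preceding arc spaces exactly in
    U(i, l-1) + U(i+1, l-1). Hence a label-preserving linear embedding can be
    extended from arc to arc as soon as corresponding arc spaces of the two
    trellises have the same dimension and the same space of labels. A trellis
    isomorphism, normalised to fix 0, maps arc spaces bijectively onto arc
    spaces and preserves labels, so over a finite field both conditions hold. *)

Set Implicit Arguments.
Unset Strict Implicit.
Unset Printing Implicit Defensive.
Import GRing.Theory.
Local Open Scope ring_scope.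

(** * Linear maps between subspaces *)

Lemma lfun_onto (K : fieldType) (X X' : vectType K)
    (C : {vspace X}) (C' : {vspace X'}) :
  \dim C = \dim C' -> exists phi : 'Hom(X, X'), (phi @: C = C')%VS.
Proof.
move=> dimC; have [f fP] := linear_of_free (vbasis C) (vbasis C').
exists (linfun f); rewrite -{1}(span_basis (vbasisP C)) limg_span.
rewrite -(span_basis (vbasisP C')) (eq_map (lfunE f)) fP //.
  exact: basis_free (vbasisP C).
by rewrite !size_tuple dimC.
Qed.

(** The pseudo-inverse of [a \o projv U] is a right inverse on the image [a @: U]; the outer
    projection brings its values into [U]. *)
Lemma lfun_section (K : fieldType) (X A : vectType K) (a : 'Hom(X, A))
    (U : {vspace X}) :
  exists g : 'Hom(A, X), {in (a @: U)%VS, forall y, g y \in U /\ a (g y) = y}.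
Proof.
pose b := (a \o projv U)%VF; exists (projv U \o b^-1)%VF => y yU.
rewrite comp_lfunE; split; first exact: memv_proj.
rewrite -[LHS]comp_lfunE limg_lfunVK // limg_comp limg_proj.
exact: yU.
Qed.

(** * Extension of label-preserving embeddings *)

Section ExtendLabelledMap.
Variables (K : fieldType) (X X' A : vectType K).
Variables (a : 'Hom(X, A)) (a' : 'Hom(X', A)).

(** Both conditions concern [S] only; a map in ['Hom(X, X')] takes arbitrary values elsewhere. *)
Definition labelled_embedding (S : {vspace X}) (psi : 'Hom(X, X')) : Prop :=
  (S :&: lker psi = 0)%VS /\ {in S, forall x, a' (psi x) = a x}.

(** The extension is [psi] on [S] and [phi] on the complement [U :\: S] of [S :&: U] in [U]. It maps
    [S + U] onto [S' + U'], and these have equal dimension, so it is injective there. *)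
Lemma embedding_extend_by (S U : {vspace X}) (S' U' : {vspace X'})
    (psi phi : 'Hom(X, X')) :
  labelled_embedding S psi -> (psi @: S = S')%VS ->
  (psi @: (S :&: U) = S' :&: U')%VS -> \dim U = \dim U' ->
  {in (U :\: S)%VS, forall x, phi x \in U' /\ a' (phi x) = a x} ->
  (U' <= psi @: (S :&: U) + phi @: (U :\: S))%VS ->
  exists2 psi2 : 'Hom(X, X'), labelled_embedding (S + U) psi2 &
    {in S, psi2 =1 psi} /\ (psi2 @: U = U')%VS.
Proof.
move=> [inj_psi lab_psi] im_S im_SU dimU phiP gen_U'.
set C := (U :\: S)%VS in phiP gen_U'.
have dxCS : (C :&: S = 0)%VS := capv_diff U S.
have dxSC : (S :&: C = 0)%VS by rewrite capvC.
pose psi2 : 'Hom(X, X') := (psi \o daddv_pi S C)%VF + (phi \o daddv_pi C S)%VF.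
have psi2S : {in S, psi2 =1 psi}.
  move=> x xS; rewrite /psi2 add_lfunE !comp_lfunE daddv_pi_id //.
  have := daddv_pi_add dxSC (subvP (addvSl S C) _ xS).
  rewrite daddv_pi_id // => /(canRL (addKr _)); rewrite addNr => ->.
  by rewrite linear0 addr0.
have psi2C : {in C, psi2 =1 phi}.
  move=> x xC; rewrite /psi2 add_lfunE !comp_lfunE (daddv_pi_id dxCS) //.
  have := daddv_pi_add dxCS (subvP (addvSl C S) _ xC).
  rewrite daddv_pi_id // => /(canRL (addKr _)); rewrite addNr => ->.
  by rewrite linear0 add0r.
have imS : (psi2 @: S = S')%VS.
  by rewrite -im_S; apply: eq_in_limg => x xS /=; exact: psi2S.
have defU : U = (S :&: U + C)%VS by rewrite addvC capvC addv_diff_cap.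
have imSU : (psi2 @: (S :&: U) = psi @: (S :&: U))%VS.
  by apply: eq_in_limg => x /memv_capP[xS _] /=; exact: psi2S.
have imC : (psi2 @: C = phi @: C)%VS by apply: eq_in_limg => x xC; exact: psi2C.
have imU : (psi2 @: U = U')%VS.
  apply/eqP; rewrite eqEsubv {1}defU {2}defU limgD imSU imC gen_U' andbT.
  rewrite subv_add im_SU capvSr /=.
  by apply/subvP => _ /memv_imgP[x xC ->]; case: (phiP _ xC).
exists psi2 => //; split; last first.
  move=> _ /memv_addP[x xS [y yU ->]]; move: yU; rewrite {1}defU.
  case/memv_addP=> y1 /memv_capP[y1S _] [y2 y2C ->].
  rewrite !linearD /= psi2S // (psi2S _ y1S) (psi2C _ y2C).
  by rewrite (lab_psi _ xS) (lab_psi _ y1S); case: (phiP _ y2C) => _ ->.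
have dimS : \dim S' = \dim S by rewrite -im_S limg_dim_eq.
have dimSU : \dim (S' :&: U') = \dim (S :&: U).
  rewrite -im_SU limg_dim_eq //; apply/eqP; rewrite -subv0 -inj_psi.
  by rewrite capvS // capvSl.
apply/eqP; rewrite -dimv_eq0.
have := limg_ker_dim psi2 (S + U); rewrite limgD imS imU.
have := dimv_sum_cap S U; have := dimv_sum_cap S' U'.
by lia.
Qed.

(* First the kernel of the labels is matched with an arbitrary linear map,
   then the rest is lifted along the labels. *)
Lemma embedding_extend (S U : {vspace X}) (S' U' : {vspace X'})
    (psi : 'Hom(X, X')) :
  labelled_embedding S psi -> (psi @: S = S')%VS ->
  (psi @: (S :&: U) = S' :&: U')%VS -> \dim U = \dim U' ->
  (a @: U = a' @: U')%VS ->
  exists2 psi2 : 'Hom(X, X'), labelled_embedding (S + U) psi2 &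
    {in S, psi2 =1 psi} /\ (psi2 @: U = U')%VS.
Proof.
move=> psiP im_S im_SU dimU labU; have [inj_psi lab_psi] := psiP.
pose N := (U :&: lker a)%VS; pose N' := (U' :&: lker a')%VS.
have dimN : \dim N = \dim N'.
  by have := limg_ker_dim a U; have := limg_ker_dim a' U'; rewrite labU -/N -/N'; lia.
have im_SN : (psi @: (S :&: N) = S' :&: N')%VS.
  apply/eqP; rewrite eqEsubv; apply/andP; split.
    apply/subvP => _ /memv_imgP[x /memv_capP[xS /memv_capP[xU xN]] ->].
    have : psi x \in (S' :&: U')%VS by rewrite -im_SU memv_img // memv_cap xS.
    rewrite !memv_cap => /andP[-> ->] /=.
    by move: xN; rewrite !memv_ker lab_psi.
  apply/subvP => y; rewrite /N' capvA => /memv_capP[]; rewrite -im_SU.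
  case/memv_imgP=> x /memv_capP[xS xU] ->; rewrite memv_ker lab_psi // => ax.
  by rewrite memv_img // !memv_cap xS xU memv_ker.
have dimSN : \dim (S :&: N) = \dim (S' :&: N').
  rewrite -im_SN limg_dim_eq //; apply/eqP; rewrite -subv0 -inj_psi.
  by rewrite capvS // capvSl.
have dimD : \dim (N :\: S) = \dim (N' :\: S').
  have := dimv_cap_compl N S; have := dimv_cap_compl N' S'.
  by rewrite (capvC N) (capvC N') dimSN dimN; lia.
have [phi im_phi] := lfun_onto dimD.
have [||psi1 psi1P [psi1S im_N]] :=
    embedding_extend_by psiP im_S im_SN dimN (phi := phi).
- move=> x xC; have : phi x \in (N' :\: S')%VS by rewrite -im_phi memv_img.
  move/(subvP (diffvSl _ _)) => phixN; split=> //.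
  have /memv_capP[_] := subvP (diffvSl _ _) _ xC.
  by case/memv_capP: phixN => _; rewrite !memv_ker => /eqP-> /eqP->.
- by rewrite im_SN im_phi addvC capvC addv_diff_cap.
have im1_S : (psi1 @: S = S')%VS by rewrite (eq_in_limg psi1S).
have im1_SN : (psi1 @: (S + N) = S' + N')%VS by rewrite limgD im1_S im_N.
(* By the modular law, enlarging [S] by [N] preserves the condition on intersections with [U]. *)
have modS : ((S + N) :&: U = S :&: U + N)%VS.
  by rewrite addvC -vspace_modl ?capvSl // addvC.
have modS' : ((S' + N') :&: U' = S' :&: U' + N')%VS.
  by rewrite addvC -vspace_modl ?capvSl // addvC.
have im1_SU : (psi1 @: ((S + N) :&: U) = (S' + N') :&: U')%VS.
  rewrite modS modS' limgD im_N -im_SU; congr (_ + _)%VS.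
  by apply: eq_in_limg => x /memv_capP[/psi1S].
have [g gP] := lfun_section a' U'.
have gaP : {in (U :\: (S + N))%VS,
    forall x, (g \o a)%VF x \in U' /\ a' ((g \o a)%VF x) = a x}.
  move=> x /(subvP (diffvSl _ _)) xU; rewrite comp_lfunE; apply: gP.
  by rewrite -labU memv_img.
have [|psi2 [inj2 lab2] [psi2S im2]] :=
    embedding_extend_by psi1P im1_SN im1_SU dimU gaP.
  (* Take [x] in [U] with the label of [y] and split it as [x1 + x2] along [U :\: (S + N)] and
     [(S + N) :&: U]. Then [y - psi1 x2 - g (a x1)] has label zero, so it lies in [N'], which [psi1]
     already reaches. *)
  apply/subvP => y yU'.
  have /memv_imgP[x xU ay] : a' y \in (a @: U)%VS by rewrite labU memv_img.
  move: xU; rewrite -{1}(addv_diff_cap U (S + N)).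
  case/memv_addP => x1 x1C [x2]; rewrite capvC => x2L def_x.
  have [gx1 agx1] := gaP _ x1C; have [_ lab1] := psi1P.
  have p2U' : psi1 x2 \in U'.
    by have := memv_img psi1 x2L; rewrite im1_SU => /memv_capP[].
  have -> : y = (y - psi1 x2 - (g \o a)%VF x1 + psi1 x2) + (g \o a)%VF x1.
    by rewrite addrAC subrK subrK.
  apply: memv_add; last exact: memv_img.
  apply: memvD; last exact: memv_img.
  rewrite im1_SU modS'; apply: subvP (addvSr _ _) _ _; rewrite memv_cap.
  apply/andP; split; first by rewrite !rpredB.
  rewrite memv_ker !linearB /= agx1 lab1.
    by rewrite ay def_x linearD /= addrK subrr.
  exact: subvP (capvSl _ _) _ x2L.
have sub2 : (S + N + U = S + U)%VS.
  by rewrite -addvA (addv_idPr (capvSl U _)).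
rewrite sub2 in inj2 lab2; exists psi2 => //; split=> // x xS.
by rewrite psi2S ?psi1S // (subvP (addvSl _ _)).
Qed.

(** Since the same [D] describes the intersections in both families, a map matching all earlier
    members also matches the intersections, which is what [embedding_extend] requires. *)
Lemma embedding_of_filtration (N : nat) (U : nat -> {vspace X})
    (U' : nat -> {vspace X'}) (D : nat -> seq nat) :
  (forall t, t < N -> all (fun s => s < t) (D t))%N ->
  (forall t, (t < N)%N ->
    ((\sum_(s < t) U s) :&: U t = \sum_(s <- D t) U s)%VS) ->
  (forall t, (t < N)%N ->
    ((\sum_(s < t) U' s) :&: U' t = \sum_(s <- D t) U' s)%VS) ->
  (forall t, (t < N)%N -> \dim (U t) = \dim (U' t)) ->
  (forall t, (t < N)%N -> (a @: U t = a' @: U' t)%VS) ->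
  exists2 psi, labelled_embedding (\sum_(s < N) U s)%VS psi &
    forall t, (t < N)%N -> (psi @: U t = U' t)%VS.
Proof.
elim: N => [|N IH] DP capU capU' dimU labU.
  exists 0 => //; rewrite big_ord0; split; first by rewrite cap0v.
  by move=> x; rewrite memv0 => /eqP->; rewrite !linear0.
have [|||||psi psiP im_psi] := IH; try by move=> t ltt; auto.
have im_sum : (psi @: (\sum_(s < N) U s) = \sum_(s < N) U' s)%VS.
  by rewrite limg_sum; apply: eq_bigr => s _; exact: im_psi.
have [|||psi2 psi2P [psi2S im2]] :=
    embedding_extend psiP im_sum (U := U N) (U' := U' N); [|auto..|].
  rewrite capU // capU' // limg_sum; apply: eq_big_seq => s /(allP (DP N _)).
  by move=> ltsN; apply: im_psi; exact: ltsN.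
exists psi2; first by rewrite big_ord_recr.
move=> t; rewrite ltnS leq_eqVlt => /predU1P[-> //|lttN].
rewrite -im_psi //; apply: eq_in_limg => x xt; apply: psi2S.
exact: (subvP (sumv_sup (Ordinal lttN) _ (subvv _))) xt.
Qed.

End ExtendLabelledMap.

(** * Counting over a finite field, and subspaces given by predicates *)

(** A subspace of dimension d has [#|F| ^ d] elements, so a merely set-theoretic injection already
    compares dimensions. *)
Lemma dimv_le_inj (F : finFieldType) (X X' : vectType F)
    (U : {vspace X}) (U' : {vspace X'}) (h : X -> X') :
  {in U &, injective h} -> {in U, forall x, h x \in U'} ->
  (\dim U <= \dim U')%N.
Proof.
move=> inj_h hU.
pose vec (r : 'rV[F]_(\dim U)) := \sum_i r 0 i *: (vbasis U)`_i.
pose crd y : 'rV[F]_(\dim U') := \row_i coord (vbasis U') i y.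
have vecU r : vec r \in U.
  by apply: memv_suml => i _; rewrite memvZ // vbasis_mem // mem_nth ?size_tuple.
have inj_vec : injective (crd \o h \o vec).
  move=> r s /rowP eq_rs.
  have eq_h : h (vec r) = h (vec s).
    rewrite (coord_vbasis (hU _ (vecU r))) (coord_vbasis (hU _ (vecU s))).
    by apply: eq_bigr => i _; have := eq_rs i; rewrite !mxE => ->.
  have := inj_h _ _ (vecU r) (vecU s) eq_h.
  move/(congr1 (fun x => \row_i coord (vbasis U) i x))/rowP => eq_vec.
  apply/rowP => i; have := eq_vec i; rewrite !mxE.
  by rewrite !coord_sum_free // (basis_free (vbasisP U)).
have := leq_card _ inj_vec; rewrite !card_mx !mul1n leq_exp2l //.
by apply/card_gt1P; exists 0, 1; rewrite eq_sym oner_neq0.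
Qed.

(** A subspace inside [P] is enlarged by a line as long as it misses some vector of [P]; the bound
    [m] on its codimension drops each time. *)
Lemma vspace_of_pred (K : fieldType) (X : vectType K) (P : X -> Prop) :
  P 0 -> (forall c x y, P x -> P y -> P (c *: x + y)) ->
  exists U : {vspace X}, forall x, x \in U <-> P x.
Proof.
move=> P0 Plin.
suff extU m (U : {vspace X}) : (\dim {:X} - \dim U <= m)%N ->
    (forall x, x \in U -> P x) ->
    exists U : {vspace X}, forall x, x \in U <-> P x.
  by apply: (extU _ 0%VS (leqnn _)) => x; rewrite memv0 => /eqP->.
elim: m U => [|m IH] U dimU UP.
  exists U => x; split=> [/UP //|_]; suff -> : U = {:X}%VS by rewrite memvf.
  by apply/eqP; rewrite eqEdim subvf /= -subn_eq0 -leqn0.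
have [PU|/not_all_ex_not[x nPU]] := classic (forall x, P x -> x \in U).
  by exists U => x; split; auto.
have [Px xU] := imply_to_and _ _ nPU.
apply: (IH (U + <[x]>)%VS).
  suff : (\dim U < \dim (U + <[x]>))%N by move: dimU; lia.
  rewrite (ltn_leqif (dimv_leqif_sup (addvSl _ _))).
  apply/negP => /subvP sUx; apply: xU; apply: sUx.
  exact: subvP (addvSr _ _) _ (memv_line x).
move=> _ /memv_addP[u uU [_ /vlineP[c ->] ->]].
by rewrite addrC; apply: Plin => //; exact: UP.
Qed.

(** * The space of cycles and its arc subspaces *)

Section CycleSpace.
Variables (F : finFieldType) (n : nat) (n_gt0 : (0 < n)%N) (M : vectType F).

(** Positions are natural numbers read modulo [n], so that [i + k] walks around the circle past its
    origin. *)
Definition cyc_ord (k : nat) : 'I_n := Ordinal (ltn_pmod k n_gt0).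

Lemma cyc_ord_eq k l : k = l %[mod n] -> cyc_ord k = cyc_ord l.
Proof. by move=> eq_kl; apply: val_inj. Qed.

Lemma ordS_cyc_ord k : ordS (cyc_ord k) = cyc_ord k.+1.
Proof. by apply: val_inj; rewrite /= -addn1 modnDml addn1. Qed.

Lemma cyc_ordP i (t : 'I_n) : exists2 k, (k < n)%N & t = cyc_ord (i + k).
Proof.
exists ((t + (n - i %% n)) %% n)%N; first exact: ltn_pmod.
apply: val_inj; rewrite /= modnDmr -modnDml.
have le_in := ltnW (ltn_pmod i n_gt0).
rewrite [X in (X %% n)%N](_ : _ = t + n)%N; last by lia.
by rewrite modnDr modn_small.
Qed.

(** One space [M] serves all positions, which makes walks a vector space; the vertex spaces are
    embedded into it later. *)
Definition walk := ({ffun 'I_n -> M} * {ffun 'I_n -> F^o})%type.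

Definition labels : 'Hom(walk, {ffun 'I_n -> F^o}) := linfun snd.

Lemma labelsE (x : walk) : labels x = x.2.
Proof. by rewrite lfunE. Qed.

(* The interior vertices of the arc are i + k with 0 < k < l, its edges are
   i + k with k < l; the arc may be the whole circle, l = n. *)
Definition on_arc (i l : nat) (x : walk) : Prop := forall k, (k < n)%N ->
  ((k == 0%N) || (l <= k)%N -> x.1 (cyc_ord (i + k)) = 0) /\
  ((l <= k)%N -> x.2 (cyc_ord (i + k)) = 0).

Lemma on_arc_lin i l c x y : on_arc i l x -> on_arc i l y ->
  on_arc i l (c *: x + y).
Proof.
move=> xP yP k ltk; have [x1 x2] := xP k ltk; have [y1 y2] := yP k ltk.
split=> hk; rewrite /= !ffunE.
  by rewrite x1 // y1 // scaler0 addr0.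
by rewrite x2 // y2 // scaler0 addr0.
Qed.

Lemma on_arc0 i l : on_arc i l 0.
Proof. by move=> k _; split=> _; rewrite ffunE. Qed.

Variable R : 'I_n -> M -> F -> M -> Prop.
Hypothesis linR : forall i, lin_edges (R i).

Lemma R0 i : R i 0 0 0. Proof. by case: (linR i). Qed.

Lemma RD i x a y x' a' y' :
  R i x a y -> R i x' a' y' -> R i (x + x') (a + a') (y + y').
Proof.
move=> r r'; have [_ /(_ 1 _ _ _ _ _ _ r r')] := linR i.
by rewrite !scale1r mul1r.
Qed.

Definition closed_walk (x : walk) : Prop :=
  forall i, R i (x.1 i) (x.2 i) (x.1 (ordS i)).

Lemma closed_walk_lin c x y :
  closed_walk x -> closed_walk y -> closed_walk (c *: x + y).
Proof.
move=> xP yP i; have [_ lin] := linR i.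
by have := lin c _ _ _ _ _ _ (xP i) (yP i); rewrite /= !ffunE.
Qed.

Lemma closed_walk0 : closed_walk 0.
Proof. by move=> i; rewrite !ffunE; exact: R0. Qed.

Definition cycle_space : {vspace walk} :=
  sval (constructive_indefinite_description _
    (vspace_of_pred closed_walk0 closed_walk_lin)).

Lemma cycle_spaceP x : x \in cycle_space <-> closed_walk x.
Proof. by rewrite /cycle_space; case: constructive_indefinite_description. Qed.

Fact arc_space_key i l : exists U : {vspace walk},
  forall x, x \in U <-> closed_walk x /\ on_arc i l x.
Proof.
apply: vspace_of_pred; first by split; [exact: closed_walk0 | exact: on_arc0].
move=> c x y [xc xa] [yc ya].
by split; [exact: closed_walk_lin | exact: on_arc_lin].
Qed.

Definition arc_space i l : {vspace walk} :=
  sval (constructive_indefinite_description _ (arc_space_key i l)).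

Lemma arc_spaceP i l x : x \in arc_space i l <-> closed_walk x /\ on_arc i l x.
Proof. by rewrite /arc_space; case: constructive_indefinite_description. Qed.

Lemma arc_space_mod i l : arc_space (i %% n) l = arc_space i l.
Proof.
have eq_ord k : cyc_ord (i %% n + k) = cyc_ord (i + k).
  by apply: cyc_ord_eq; rewrite modnDml.
apply/vspaceP => x; apply/idP/idP => /arc_spaceP[xc xa]; apply/arc_spaceP.
  by split=> // k ltk; have := xa k ltk; rewrite eq_ord.
by split=> // k ltk; have := xa k ltk; rewrite eq_ord.
Qed.

Lemma arc_space_sub i l : (arc_space i l <= cycle_space)%VS.
Proof. by apply/subvP => x /arc_spaceP[xc _]; apply/cycle_spaceP. Qed.

(** This links arcs to vertices: two cycles agree at position [i] exactly when their difference lies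
    in this space. *)
Lemma arc_space_full i x :
  x \in arc_space i n <-> x \in cycle_space /\ x.1 (cyc_ord i) = 0.
Proof.
split=> [/arc_spaceP[xc xa]|[/cycle_spaceP xc x0]].
  split; first exact/cycle_spaceP.
  by have [+ _] := xa 0%N n_gt0; rewrite addn0; apply.
apply/arc_spaceP; split=> // k ltk; split; last by rewrite leqNgt ltk.
by rewrite leqNgt ltk orbF => /eqP->; rewrite addn0.
Qed.

Lemma arc_space_le i l : (arc_space i l <= arc_space i l.+1)%VS.
Proof.
apply/subvP => x /arc_spaceP[xc xa]; apply/arc_spaceP; split=> // k ltk.
have [x1 x2] := xa k ltk; split=> hk; [apply: x1 | apply: x2]; lia.
Qed.

Lemma arc_space_leS i l : (l < n)%N -> (arc_space i.+1 l <= arc_space i l.+1)%VS.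
Proof.
move=> ltl; apply/subvP => x /arc_spaceP[xc xa]; apply/arc_spaceP; split=> //.
case=> [_|k ltk].
  (* The vertex [i] is at distance [n - 1] from [i + 1], hence outside the shorter arc because
     [l < n]. *)
  have [x1 _] := xa n.-1 ltac:(lia); split=> // _.
  rewrite (@cyc_ord_eq _ (i.+1 + n.-1)); first by apply: x1; lia.
  by rewrite (_ : i.+1 + n.-1 = i + 0 + n)%N ?modnDr //; lia.
have [x1 x2] := xa k ltac:(lia); rewrite addnS -addSn; split=> hk.
  by apply: x1; lia.
by apply: x2; lia.
Qed.

(** * Cutting cycles at a zero vertex and closing the pieces *)

(** Indexing by the distance from [i] lets a path around the full circle, [l = n], have two
    different ends. *)
Definition pathR (i l : nat) (p : nat -> M) (b : nat -> F) : Prop :=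
  forall k, (k < l)%N -> R (cyc_ord (i + k)) (p k) (b k) (p k.+1).

Lemma pathRD i l p b q c : pathR i l p b -> pathR i l q c ->
  pathR i l (fun k => p k + q k) (fun k => b k + c k).
Proof. by move=> pP qP k ltk; apply: RD; [exact: pP | exact: qP]. Qed.

Lemma close_path i l p b : (l <= n)%N -> pathR i l p b -> p 0%N = 0 -> p l = 0 ->
  exists2 y, closed_walk y & forall k, (k < n)%N ->
    y.1 (cyc_ord (i + k)) = (if (k < l)%N then p k else 0) /\
    y.2 (cyc_ord (i + k)) = (if (k < l)%N then b k else 0).
Proof.
move=> le_ln pP p0 pl.
(* The forward distance from [i] to [t]. *)
pose d (t : 'I_n) := ((t + (n - i %% n)) %% n)%N.
have dE k : (k < n)%N -> d (cyc_ord (i + k)) = k.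
  move=> ltk; rewrite /d /= modnDml.
  have le_in := ltnW (ltn_pmod i n_gt0).
  rewrite [X in (X %% n)%N](_ : _ = (i %/ n).+1 * n + k)%N.
    by rewrite modnMDl modn_small.
  by rewrite mulSn; have := divn_eq i n; lia.
pose y : walk := ([ffun t => if (d t < l)%N then p (d t) else 0],
                  [ffun t => if (d t < l)%N then b (d t) else 0]).
have yE k : (k < n)%N ->
    y.1 (cyc_ord (i + k)) = (if (k < l)%N then p k else 0) /\
    y.2 (cyc_ord (i + k)) = (if (k < l)%N then b k else 0).
  by move=> ltk; rewrite !ffunE dE.
exists y => // t; have [k ltk ->] := cyc_ordP i t.
rewrite ordS_cyc_ord -addnS; have [-> ->] := yE k ltk.
(* For [k.+1 = n] the position wraps around to [i], where the value is zero because [p 0 = 0]. *)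
have y1E : y.1 (cyc_ord (i + k.+1)) = if (k.+1 < l)%N then p k.+1 else 0.
  have [ltk1|gek1] := ltnP k.+1 n; first by case: (yE _ ltk1).
  have eqk1 : k.+1 = n by lia.
  rewrite (@cyc_ord_eq _ (i + 0)) ?eqk1 ?addn0 ?modnDr // -[in LHS](addn0 i).
  by have [-> _] := yE 0%N n_gt0; rewrite p0 if_same ltnNge le_ln.
rewrite {}y1E; have [ltkl|lekl] := ltnP k l.
  have [_|lek1] := ltnP k.+1 l; first exact: pP.
  by have := pP k ltkl; rewrite (_ : k.+1 = l) ?pl //; lia.
by rewrite ltnNge (leq_trans lekl) //=; exact: R0.
Qed.

(* On the arc (i, l), x is the sum of a path that has died before the last
   edge and a path that is born after the first one. *)
Definition splits (i l : nat) (x : walk) : Prop :=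
  exists p b q c, [/\ pathR i l p b, pathR i l q c,
    (forall k, (k <= l)%N -> x.1 (cyc_ord (i + k)) = p k + q k),
    (forall k, (k < l)%N -> x.2 (cyc_ord (i + k)) = b k + c k)
    & [/\ p l.-1 = 0, p l = 0 & b l.-1 = 0] /\
      [/\ q 0%N = 0, q 1%N = 0 & c 0%N = 0]].

Lemma splitsD i l x y : splits i l x -> splits i l y -> splits i l (x + y).
Proof.
move=> [p [b [q [c [pP qP x1 x2 [[pl1 pl bl] [q0 q1 c0]]]]]]].
move=> [p' [b' [q' [c' [pP' qP' x1' x2' [[pl1' pl' bl'] [q0' q1' c0']]]]]]].
exists (fun k => p k + p' k), (fun k => b k + b' k).
exists (fun k => q k + q' k), (fun k => c k + c' k); split.
- exact: pathRD.
- exact: pathRD.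
- by move=> k lek; rewrite ffunE x1 // x1' // addrACA.
- by move=> k ltk; rewrite ffunE x2 // x2' // addrACA.
by rewrite pl1 pl1' pl pl' bl bl' q0 q0' q1 q1' c0 c0' !addr0.
Qed.

Lemma splits_vanish i l (x : walk) :
  (forall k, (k <= l)%N -> x.1 (cyc_ord (i + k)) = 0) ->
  (forall k, (k < l)%N -> x.2 (cyc_ord (i + k)) = 0) -> splits i l x.
Proof.
move=> x1 x2; exists (fun=> 0), (fun=> 0), (fun=> 0), (fun=> 0); split=> //.
- by move=> k _; exact: R0.
- by move=> k _; exact: R0.
- by move=> k /x1->; rewrite addr0.
- by move=> k /x2->; rewrite addr0.
Qed.

(** Follow [x] up to [m] and stay at zero afterwards, or the other way round: the zero vertex at [m]
    and the zero edges make both pieces paths. *)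
Lemma splits_cut i l (x : walk) m : closed_walk x -> (0 < m < l)%N ->
  x.1 (cyc_ord (i + m)) = 0 -> splits i l x.
Proof.
move=> xc /andP[m_gt0 ltml] xm.
pose u k := x.1 (cyc_ord (i + k)); pose a k : F := x.2 (cyc_ord (i + k)).
have uP k : R (cyc_ord (i + k)) (u k) (a k) (u k.+1).
  by have := xc (cyc_ord (i + k)); rewrite ordS_cyc_ord -addnS.
exists (fun k => if (k < m)%N then u k else 0).
exists (fun k => if (k < m)%N then a k else 0).
exists (fun k => if (k < m)%N then 0 else u k).
exists (fun k => if (k < m)%N then 0 else a k); split.
- move=> k _ /=; have [ltkm|lemk] := ltnP k m.
    have [ltk1m|lemk1] := ltnP k.+1 m; first exact: uP.
    by have := uP k; rewrite (_ : k.+1 = m) ?[u m]xm //; lia.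
  by rewrite ltnNge (leq_trans lemk) //=; exact: R0.
- move=> k _ /=; have [ltkm|lemk] := ltnP k m.
    have [ltk1m|lemk1] := ltnP k.+1 m; first exact: R0.
    by rewrite (_ : k.+1 = m) ?[u m]xm //; [exact: R0 | lia].
  by rewrite ltnNge (leq_trans lemk) //=; exact: uP.
- by move=> k _; case: ifP; rewrite ?addr0 ?add0r.
- by move=> k _; case: ifP; rewrite ?addr0 ?add0r.
(* As [m] is at most [l - 1], the first piece is gone before the last edge; as [m] is at least 1,
   the second is absent on the first edge. *)
have -> : (l.-1 < m)%N = false by lia.
have -> : (l < m)%N = false by lia.
rewrite m_gt0; split=> //; split=> //; case: ltnP => // lem1.
by rewrite (_ : 1%N = m) //; lia.
Qed.

(** A different arc that is no longer than [(i, l)] cannot contain all its interior vertices, so [x]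
    can be cut at a missing one. For [l = 1] there is no interior vertex, and [x] vanishes on the
    arc. *)
Lemma splits_other_arc i l j l' (x : walk) : (0 < l <= n)%N -> (l' <= l)%N ->
  (i < n)%N -> (j < n)%N -> (j, l') != (i, l) ->
  x \in arc_space j l' -> splits i l x.
Proof.
move=> /andP[l_gt0 le_ln] le_l'l ltin ltjn neq /arc_spaceP[xc xa].
(* The forward distance from [j] to [i]. *)
pose d := ((i + (n - j)) %% n)%N.
have ltd : (d < n)%N by exact: ltn_pmod.
have dE k : (j + (d + k) = i + k %[mod n])%N.
  rewrite addnA -modnDml /d modnDmr.
  by rewrite [X in (X %% n + _)%N](_ : _ = i + n)%N ?modnDr ?modnDml //; lia.
have x1 k m : (m < n)%N -> (d + k = m \/ d + k = m + n)%N ->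
    (m == 0%N) || (l' <= m)%N -> x.1 (cyc_ord (i + k)) = 0.
  move=> ltm eqm hm; have [+ _] := xa m ltm; move/(_ hm) <-; congr (x.1 _).
  apply: cyc_ord_eq; rewrite -dE; case: eqm => ->//.
  by rewrite addnA modnDr.
have [d0|d_gt0] := posnP d.
  have eq_ij : i = j.
    move: d0; rewrite /d; have [leji|ltij] := leqP j i.
      rewrite [X in (X %% n)%N](_ : _ = i - j + n)%N; last by lia.
      by rewrite modnDr modn_small; lia.
    by rewrite modn_small; lia.
  have lt_l'l : (l' < l)%N.
    by move: neq; rewrite eq_ij xpair_eqE eqxx /=; lia.
  have [l1|l_gt1] := leqP l 1; last first.
    apply: (@splits_cut _ _ _ l.-1) => //; first by lia.
    by apply: (@x1 _ l.-1); lia.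
  have x10 t : x.1 t = 0.
    have [k ltk ->] := cyc_ordP j t; have [+ _] := xa k ltk; apply; lia.
  have x20 t : x.2 t = 0.
    have [k ltk ->] := cyc_ordP j t; have [_] := xa k ltk; apply; lia.
  exact: splits_vanish.
have [l1|l_gt1] := leqP l 1.
  have x10 t : x.1 t = 0.
    have [k ltk ->] := cyc_ordP j t; have [+ _] := xa k ltk; apply; lia.
  apply: splits_vanish => // k ltk; have -> : k = 0%N by lia.
  have [_ <-] := xa d ltd; last by lia.
  by congr (x.2 _); apply: cyc_ord_eq; rewrite -dE addn0.
(* Either [j] itself is interior to [(i, l)], at distance [n - d] from [i], or the last interior
   vertex of [(i, l)] lies at distance [d + l.-1 >= l'] from [j]; [x] vanishes there. *)
have [wrap|nowrap] := leqP n (d + l.-1).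
  apply: (@splits_cut _ _ _ (n - d)) => //; first by lia.
  by apply: (@x1 _ 0%N); lia.
apply: (@splits_cut _ _ _ l.-1) => //; first by lia.
by apply: (@x1 _ (d + l.-1)%N); lia.
Qed.

(** As [x] is zero at both ends of the arc, so are the two pieces; [close_path] turns them into
    cycles, the first avoiding the last edge and the second the first edge. *)
Lemma splits_arc_space i l x : (l < n)%N -> x \in arc_space i l.+1 ->
  splits i l.+1 x -> x \in (arc_space i l + arc_space i.+1 l)%VS.
Proof.
move=> ltln /arc_spaceP[xc xa].
move=> [p [b [q [c [pP qP x1 x2 [[pl1 pl bl] [q0 q1 c0]]]]]]].
have xi : x.1 (cyc_ord (i + 0)) = 0 by have [+ _] := xa 0%N n_gt0; apply.
have xl : x.1 (cyc_ord (i + l.+1)) = 0.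
  have [ltl1|gel1] := ltnP l.+1 n; first by have [+ _] := xa _ ltl1; apply; lia.
  rewrite (@cyc_ord_eq _ (i + 0)) //.
  by rewrite (_ : l.+1 = n) ?modnDr ?addn0 //; lia.
have p0 : p 0%N = 0 by have := x1 0%N isT; rewrite xi q0 addr0.
have ql : q l.+1 = 0 by have := x1 l.+1 (leqnn _); rewrite xl pl add0r.
have [y yc yE] := close_path ltln pP p0 pl.
have [z zc zE] := close_path ltln qP q0 ql.
have -> : x = y + z.
  apply/eqP; rewrite -pair_eqE /=; apply/andP; split; apply/eqP/ffunP => t.
    have [k ltk ->] := cyc_ordP i t; rewrite !ffunE.
    have [-> _] := yE k ltk; have [-> _] := zE k ltk.
    case: ltnP => [ltkl|lekl]; first by rewrite x1 // ltnW.
    by have [+ _] := xa k ltk; rewrite addr0; apply; rewrite lekl orbT.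
  have [k ltk ->] := cyc_ordP i t; rewrite !ffunE.
  have [_ ->] := yE k ltk; have [_ ->] := zE k ltk.
  case: ltnP => [ltkl|lekl]; first by rewrite x2.
  by have [_ +] := xa k ltk; rewrite addr0; apply.
apply: memv_add; apply/arc_spaceP; split=> // k ltk.
  have [-> ->] := yE k ltk; split=> [hk|lek]; case: ltnP => // ltk1.
    case/orP: hk => [/eqP-> //|lek]; suff -> : k = l by [].
    by lia.
  by have -> : k = l by lia.
(* Distance [k] from [i + 1] is distance [k + 1] from [i], except that [k = n - 1] wraps back to
   [i]. *)
have [ltk1|gek1] := ltnP k.+1 n.
  rewrite addSn -addnS; have [-> ->] := zE _ ltk1; rewrite ltnS.
  split=> [hk|lek]; case: ltnP => // ltkl; last by lia.
  by case/orP: hk => [/eqP-> //|lek]; lia.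
have -> : cyc_ord (i.+1 + k) = cyc_ord (i + 0).
  by apply: cyc_ord_eq; rewrite addSn -addnS (_ : k.+1 = n) ?modnDr ?addn0 //; lia.
by have [-> ->] := zE 0%N n_gt0; rewrite q0 c0.
Qed.

(* Arcs are enumerated by increasing length: number t is the arc with t %/ n
   edges that starts at t %% n. *)
Definition arc (t : nat) : {vspace walk} := arc_space (t %% n) (t %/ n).

(** If [t] numbers the arc [(i, l)], these number [(i, l - 1)] and [(i + 1, l - 1)], the start taken
    modulo [n]. Arcs without edges have none. *)
Definition lower_arcs (t : nat) : seq nat :=
  if (t < n)%N then [::]
  else [:: t - n; (t %/ n).-1 * n + (t %% n).+1 %% n]%N.

Lemma lower_arcs_lt t : all (fun s => s < t)%N (lower_arcs t).
Proof.
rewrite /lower_arcs; case: ltnP => //= le_nt.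
have lt1 : (0 < t %/ n)%N by rewrite divn_gt0.
have := divn_eq t n; have := ltn_pmod t n_gt0; have := ltn_pmod (t %% n).+1%N n_gt0.
by move: (t %/ n)%N lt1 => [//|l] _; rewrite mulSn /= andbT; lia.
Qed.

(** The bound on [t] allows the lengths 0 to [n]. Members of earlier arc spaces split along arc [t],
    and splitting is additive, so an element of the intersection splits and [splits_arc_space]
    applies. Conversely, both lower arcs come earlier and lie within arc [t]. *)
Lemma arc_cap t : (t < n * n.+1)%N ->
  ((\sum_(s < t) arc s) :&: arc t = \sum_(s <- lower_arcs t) arc s)%VS.
Proof.
move=> ltt; have le_ln : (t %/ n <= n)%N.
  by rewrite -ltnS ltn_divLR // mulnC.
have := lower_arcs_lt t; rewrite /lower_arcs.
case: ltnP => [lttn _|le_nt].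
  (* An arc of length zero forces every vertex and every label to vanish. *)
  rewrite big_nil; apply/eqP; rewrite -subv0; apply/subvP => x.
  rewrite memv_cap => /andP[_]; rewrite /arc divn_small // => /arc_spaceP[_ xa].
  suff -> : x = 0 by rewrite mem0v.
  apply/eqP; rewrite -pair_eqE; apply/andP; split; apply/eqP/ffunP => s.
    have [k ltk ->] := cyc_ordP (t %% n)%N s; rewrite ffunE.
    by have [+ _] := xa k ltk; apply; rewrite orbT.
  have [k ltk ->] := cyc_ordP (t %% n)%N s; rewrite ffunE.
  by have [_ +] := xa k ltk; apply.
rewrite /= andbT => /andP[lt1 lt2].
have lt_in := ltn_pmod t n_gt0; have def_t := divn_eq t n.
have l_gt0 : (0 < t %/ n)%N by rewrite divn_gt0.
have arcE i l : (i < n)%N -> arc (l * n + i) = arc_space i l.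
  by move=> lti; rewrite /arc modnMDl divnMDl // divn_small // addn0 modn_small.
have arct : arc t = arc_space (t %% n)%N (t %/ n)%N by [].
have E1 : arc (t - n) = arc_space (t %% n)%N (t %/ n).-1%N.
  rewrite -arcE //; congr arc.
  by move: (t %/ n)%N l_gt0 def_t => [//|l] _; rewrite mulSn /=; lia.
have E2 : arc ((t %/ n).-1 * n + (t %% n).+1 %% n)%N
    = arc_space (t %% n).+1%N (t %/ n).-1%N.
  by rewrite arcE ?ltn_pmod // arc_space_mod.
rewrite !big_cons big_nil addv0 E1 E2.
apply/eqP; rewrite eqEsubv; apply/andP; split.
  apply/subvP => x /memv_capP[/memv_sumP[xs xsP ->]].
  move: (t %/ n)%N (t %% n)%N l_gt0 def_t le_ln lt_in arct.
  move=> [//|l] i _ def_t ltln lti -> /= xt.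
  apply: splits_arc_space => //; apply: big_ind.
  - by apply: splits_vanish => k _; rewrite ffunE.
  - by move=> y z; exact: splitsD.
  move=> s _; apply: splits_other_arc (xsP s isT) => //=; rewrite ?ltn_pmod //.
    have := leq_div2r n (ltnW (ltn_ord s)); rewrite {2}def_t divnMDl //.
    by rewrite (divn_small lti) addn0.
  (* Equal start and length would give [s = t]. *)
  apply/negP => /eqP[eqi eql]; have := divn_eq s n; rewrite eqi eql -def_t.
  by have := ltn_ord s; lia.
rewrite subv_cap; apply/andP; split.
  rewrite -E1 -E2 subv_add.
  by rewrite (sumv_sup (Ordinal lt1)) ?(sumv_sup (Ordinal lt2)).
rewrite arct; move: (t %/ n)%N (t %% n)%N l_gt0 le_ln => [//|l] i _ ltln /=.
by rewrite subv_add arc_space_le arc_space_leS.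
Qed.

Lemma arc_full i : (i < n)%N -> arc (n * n + i) = arc_space i n.
Proof.
by move=> lti; rewrite /arc modnMDl divnMDl // divn_small // addn0 modn_small.
Qed.

End CycleSpace.

(** * Linear isomorphism of the cycle spaces *)

(** The filtration by arcs gives an embedding of their sum; one last extension reaches all cycles.
    There the intersection condition is immediate, as every arc space consists of cycles. *)
Lemma cycle_space_iso (F : finFieldType) (n : nat) (n_gt0 : (0 < n)%N)
    (M M' : vectType F) (R : 'I_n -> M -> F -> M -> Prop)
    (R' : 'I_n -> M' -> F -> M' -> Prop)
    (linR : forall i, lin_edges (R i)) (linR' : forall i, lin_edges (R' i)) :
  (forall i l,
    \dim (arc_space n_gt0 linR i l) = \dim (arc_space n_gt0 linR' i l)) ->
  (forall i l, labels n M @: arc_space n_gt0 linR i l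
             = labels n M' @: arc_space n_gt0 linR' i l)%VS ->
  \dim (cycle_space linR) = \dim (cycle_space linR') ->
  (labels n M @: cycle_space linR = labels n M' @: cycle_space linR')%VS ->
  exists psi, [/\
    labelled_embedding (labels n M) (labels n M') (cycle_space linR) psi,
    (psi @: cycle_space linR = cycle_space linR')%VS &
    forall i, (i < n)%N ->
      (psi @: arc_space n_gt0 linR i n = arc_space n_gt0 linR' i n)%VS].
Proof.
move=> dimA labA dimC labC.
have [|||||psi psiP im_psi] := @embedding_of_filtration _ _ _ _
  (labels n M) (labels n M') (n * n.+1) (arc n_gt0 linR) (arc n_gt0 linR')
  (lower_arcs n).
- by move=> t _; exact: lower_arcs_lt.
- by move=> t; exact: arc_cap.
- by move=> t; exact: arc_cap.
- by move=> t _; exact: dimA.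
- by move=> t _; exact: labA.
set S := (\sum_(s < _) _)%VS in psiP.
pose S' := (\sum_(s < n * n.+1) arc n_gt0 linR' s)%VS.
have im_S : (psi @: S = S')%VS.
  by rewrite limg_sum; apply: eq_bigr => s _; exact: im_psi.
have sSC : (S <= cycle_space linR)%VS.
  by apply/subv_sumP => s _; exact: arc_space_sub.
have sSC' : (S' <= cycle_space linR')%VS.
  by apply/subv_sumP => s _; exact: arc_space_sub.
have [|||psi2 psi2P [psi2S im2]] := embedding_extend psiP im_S
    (U := cycle_space linR) (U' := cycle_space linR'); [|done..|].
  by rewrite (capv_idPl sSC) (capv_idPl sSC').
exists psi2; split=> //; first by rewrite (addv_idPr sSC) in psi2P.
move=> i lti; rewrite -(arc_full _ linR lti) -(arc_full _ linR' lti).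
have ltN : (n * n + i < n * n.+1)%N by rewrite mulnS addnC ltn_add2r.
rewrite -im_psi //; apply: eq_in_limg => x xi; apply: psi2S.
exact: (subvP (sumv_sup (Ordinal ltN) _ (subvv _))) xi.
Qed.

(** * Embedding the vertex spaces into one coordinate space *)

(** All elements of [M] together span it, so [M] is the quotient of a coordinate space by the
    relations [K]; a complement of [K] gives the embedding. *)
Lemma finLmod_embedding (F : finFieldType) (M : finLmodType F) (D : nat) :
  (#|M| <= D)%N -> exists jr : (M -> 'rV[F]_D) * ('rV[F]_D -> M),
    (forall c x y, jr.1 (c *: x + y) = c *: jr.1 x + jr.1 y) /\
    cancel jr.1 jr.2.
Proof.
move=> leD; pose e (k : 'I_D) : M := nth 0 (enum M) k.
pose s (v : 'rV[F]_D) : M := \sum_k v 0 k *: e k.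
have s_lin c v w : s (c *: v + w) = c *: s v + s w.
  rewrite /s scaler_sumr -big_split; apply: eq_bigr => k _ /=.
  by rewrite !mxE scalerDl scalerA.
have s0 : s 0 = 0 by rewrite /s big1 // => k _; rewrite mxE scale0r.
have [||K KP] := @vspace_of_pred _ _ (fun v => s v = 0) => //.
  by move=> c v w sv sw; rewrite s_lin sv sw scaler0 addr0.
pose pre (x : M) : 'rV[F]_D := delta_mx 0 (widen_ord leD (enum_rank x)).
have preK x : s (pre x) = x.
  rewrite /s (bigD1 (widen_ord leD (enum_rank x))) //= big1 => [|k neq].
    by rewrite mxE !eqxx scale1r addr0 /e /= nth_enum_rank.
  by rewrite mxE (negPf neq) andbF scale0r.
(* [L] kills [K] and preserves [s]; thus it makes the non-linear lift [pre] linear while keeping it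
   a lift. *)
have [L LE] : exists L : 'End('rV[F]_D), forall v, L v = v - projv K v.
  by exists (\1%VF - projv K) => v; rewrite add_lfunE opp_lfunE id_lfunE.
exists (L \o pre, s); split=> /= [c x y|x]; last first.
  have sp : s (projv K (pre x)) = 0 by apply/KP; exact: memv_proj.
  by rewrite /= LE addrC -scaleN1r s_lin sp scaler0 add0r preK.
pose z := pre (c *: x + y) - (c *: pre x + pre y).
have zK : z \in K.
  by apply/KP; rewrite /z addrC -scaleN1r !s_lin !preK scaleN1r addNr.
have Lz : L z = 0 by rewrite LE projv_id ?subrr.
by rewrite -linearP; apply/eqP; rewrite -subr_eq0 -linearB; apply/eqP.
Qed.

Section Embedding.
Variables (F : finFieldType) (n D : nat) (V : 'I_n -> finLmodType F).
Variable E : forall i : 'I_n, V i -> F -> V (ordS i) -> Prop.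
Variables (j : forall i, V i -> 'rV[F]_D) (r : forall i, 'rV[F]_D -> V i).
Arguments j : clear implicits.
Arguments r : clear implicits.
Hypothesis j_lin : forall i c x y, j i (c *: x + y) = c *: j i x + j i y.
Hypothesis jK : forall i, cancel (j i) (r i).

Definition embed_edges (i : 'I_n) (x : 'rV[F]_D) (al : F) (y : 'rV[F]_D) :=
  exists u w, [/\ x = j i u, y = j (ordS i) w & E u al w].

Lemma embed0 i : j i 0 = 0.
Proof. by have := @j_lin i (-1) 0 0; rewrite scaler0 addr0 scaleN1r addNr. Qed.

Lemma embed_edges_lin : linear_trellis E -> forall i, lin_edges (embed_edges i).
Proof.
move=> linE i; have [E0 Elin] := linE i; split.
  by exists 0, 0; rewrite !embed0.
move=> c _ a _ _ a' _ [u [w [-> -> e]]] [u' [w' [-> -> e']]].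
exists (c *: u + u'), (c *: w + w'); rewrite !j_lin; split=> //.
exact: Elin.
Qed.

(** Every vertex of a closed walk starts an edge, hence lies in the image of [j]. *)
Lemma closed_walk_embed (x : walk n 'rV[F]_D) : closed_walk embed_edges x <->
  (forall i, j i (r i (x.1 i)) = x.1 i) /\
  is_cycle E (fun i => r i (x.1 i)) x.2.
Proof.
split=> [xc|[xj xE] i].
  split=> i; have [u [w [xu xw e]]] := xc i; first by rewrite xu jK.
  by rewrite xu xw !jK.
by exists (r i (x.1 i)), (r (ordS i) (x.1 (ordS i))); rewrite !xj.
Qed.

Lemma closed_walk_of_cycle v a : is_cycle E v a ->
  closed_walk embed_edges
    ([ffun i => j i (v i)], [ffun i => a i] : {ffun 'I_n -> F^o}).
Proof.
by move=> va i; exists (v i), (v (ordS i)); rewrite !ffunE.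
Qed.

End Embedding.

Lemma trellis_embedding (F : finFieldType) (n : nat)
    (V : 'I_n -> finLmodType F) :
  exists D (j : forall i, V i -> 'rV[F]_D) (r : forall i, 'rV[F]_D -> V i),
    (forall i c x y, j i (c *: x + y) = c *: j i x + j i y) /\
    (forall i, cancel (j i) (r i)).
Proof.
(* A common bound puts all positions into the same space. *)
pose D := (\max_i #|V i|)%N.
have leD i : (#|V i| <= D)%N by exact: (leq_bigmax i).
pose w i := constructive_indefinite_description _ (finLmod_embedding (leD i)).
exists D, (fun i => (sval (w i)).1), (fun i => (sval (w i)).2).
by split=> i; case: (svalP (w i)).
Qed.

(** * Transport of cycles along a trellis isomorphism *)

Lemma trellis_iso_sym (F : finFieldType) (n : nat) (V W : 'I_n -> Type)
    (E : forall i : 'I_n, V i -> F -> V (ordS i) -> Prop)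
    (E' : forall i : 'I_n, W i -> F -> W (ordS i) -> Prop)
    (f : forall i, V i -> W i) :
  trellis_iso E E' f ->
  exists2 g, trellis_iso E' E g & forall i, cancel (f i) (g i).
Proof.
move=> [f_bij fE].
have ex_g i : exists g, cancel (f i) g /\ cancel g (f i).
  by case: (f_bij i) => g fK gK; exists g.
pose g i := sval (constructive_indefinite_description _ (ex_g i)).
have gP i : cancel (f i) (g i) /\ cancel (g i) (f i).
  by rewrite /g; case: constructive_indefinite_description.
exists g => [|i]; last by case: (gP i).
split=> [i|i x al y]; first by case: (gP i) => fK gK; exists (f i).
by rewrite fE (proj2 (gP i)) (proj2 (gP (ordS i))).
Qed.

(* Subtracting the image of the zero cycle, which is a cycle with zero labels. *)
Lemma trellis_iso_pointed (F : finFieldType) (n : nat)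
    (V W : 'I_n -> finLmodType F)
    (E : forall i : 'I_n, V i -> F -> V (ordS i) -> Prop)
    (E' : forall i : 'I_n, W i -> F -> W (ordS i) -> Prop)
    (f : forall i, V i -> W i) :
  linear_trellis E -> linear_trellis E' -> trellis_iso E E' f ->
  exists2 g : forall i, V i -> W i, trellis_iso E E' g & forall i, g i 0 = 0.
Proof.
move=> linE linE' [f_bij fE].
have E'0 i : E' i (f i 0) 0 (f (ordS i) 0) by apply/fE; case: (linE i).
exists (fun i x => f i x - f i 0) => [|i]; last by rewrite subrr.
split=> [i|i x al y].
  have [g fK gK] := f_bij i; exists (fun y => g (y + f i 0)) => x.
    by rewrite subrK fK.
  by rewrite gK addrK.
have [_ lin] := linE' i; rewrite fE; split=> e.
  have := lin (-1) _ _ _ _ _ _ (E'0 i) e.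
  by rewrite !scaleN1r mulr0 add0r ![- f _ _ + _]addrC.
have := lin 1 _ _ _ _ _ _ e (E'0 i).
by rewrite !scale1r mul1r addr0 !subrK.
Qed.

Section TransportCycles.
Variables (F : finFieldType) (n D D' : nat) (n_gt0 : (0 < n)%N).
Variables (V W : 'I_n -> finLmodType F).
Variable E : forall i : 'I_n, V i -> F -> V (ordS i) -> Prop.
Variable E' : forall i : 'I_n, W i -> F -> W (ordS i) -> Prop.
Variables (j : forall i, V i -> 'rV[F]_D) (r : forall i, 'rV[F]_D -> V i).
Variables (j' : forall i, W i -> 'rV[F]_D') (r' : forall i, 'rV[F]_D' -> W i).
Arguments r' : clear implicits.
Arguments j : clear implicits.
Arguments r : clear implicits.
Arguments j' : clear implicits.
Hypothesis j_lin : forall i c x y, j i (c *: x + y) = c *: j i x + j i y.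
Hypothesis jK : forall i, cancel (j i) (r i).
Hypothesis j'_lin : forall i c x y, j' i (c *: x + y) = c *: j' i x + j' i y.
Hypothesis j'K : forall i, cancel (j' i) (r' i).
Hypotheses (linE : linear_trellis E) (linE' : linear_trellis E').
Variable f : forall i, V i -> W i.
Arguments f : clear implicits.
Hypotheses (fP : trellis_iso E E' f) (f0 : forall i, f i 0 = 0).

Let R := embed_edges E j.
Let R' := embed_edges E' j'.
Let linR : forall i, lin_edges (R i) := embed_edges_lin j_lin linE.
Let linR' : forall i, lin_edges (R' i) := embed_edges_lin j'_lin linE'.

(** In general not linear; it serves only for counting and for comparing labels. *)
Let h (x : walk n 'rV[F]_D) : walk n 'rV[F]_D' :=
  ([ffun i => j' i (f i (r i (x.1 i)))], x.2).

Lemma transport_closed x : closed_walk R x -> closed_walk R' (h x).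
Proof.
move=> /(closed_walk_embed _ jK)[_ xc]; have [_ fE] := fP => i.
exists (f i (r i (x.1 i))), (f (ordS i) (r (ordS i) (x.1 (ordS i)))).
by rewrite !ffunE; split=> //; apply/fE/xc.
Qed.

Lemma transport_inj x y :
  closed_walk R x -> closed_walk R y -> h x = h y -> x = y.
Proof.
move=> /(closed_walk_embed _ jK)[xj _] /(closed_walk_embed _ jK)[yj _].
case: x y xj yj => [x1 x2] [y1 y2] /= xj yj [/ffunP eq1 ->]; congr pair.
apply/ffunP => i; have := eq1 i; rewrite !ffunE => /(can_inj (@j'K i)) eqf.
have [/(_ i)/bij_inj inj_f _] := fP.
by rewrite -xj -yj (inj_f _ _ eqf).
Qed.

(** Here the normalisation [f0] enters: zero vertices stay zero. *)
Lemma transport_arc i l x : on_arc n_gt0 i l x -> on_arc n_gt0 i l (h x).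
Proof.
move=> xa k ltk; have [x1 x2] := xa k ltk; split=> hk; last exact: x2.
have r0 t : r t 0 = 0 by rewrite -(embed0 j_lin t) jK.
by rewrite ffunE x1 // r0 f0 (embed0 j'_lin).
Qed.

(** Dimensions compare because [h] is injective on closed walks, label spaces because [h] keeps
    labels. *)
Lemma transport_space (U : {vspace walk n 'rV[F]_D})
    (U' : {vspace walk n 'rV[F]_D'}) :
  (forall x, x \in U -> closed_walk R x) ->
  (forall x, x \in U -> h x \in U') ->
  (\dim U <= \dim U')%N /\ (labels n _ @: U <= labels n _ @: U')%VS.
Proof.
move=> Uc hU; split.
  by apply: dimv_le_inj hU => x y /Uc xc /Uc yc; exact: transport_inj.
apply/subvP => _ /memv_imgP[x xU ->]; apply/memv_imgP.
by exists (h x); [exact: hU | rewrite !labelsE].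
Qed.

Lemma transport_cycle_space :
  (\dim (cycle_space linR) <= \dim (cycle_space linR'))%N /\
  (labels n _ @: cycle_space linR <= labels n _ @: cycle_space linR')%VS.
Proof.
apply: transport_space => x /cycle_spaceP xc //.
by apply/cycle_spaceP; exact: transport_closed.
Qed.

Lemma transport_arc_space i l :
  (\dim (arc_space n_gt0 linR i l) <= \dim (arc_space n_gt0 linR' i l))%N /\
  (labels n _ @: arc_space n_gt0 linR i l
    <= labels n _ @: arc_space n_gt0 linR' i l)%VS.
Proof.
apply: transport_space => x /arc_spaceP[xc xa] //.
by apply/arc_spaceP; split; [exact: transport_closed | exact: transport_arc].
Qed.

End TransportCycles.

(** * From the cycle spaces back to the trellises *)

Lemma bijection_of_relation (A B : Type) (G : A -> B -> Prop) :
  (forall x, exists y, G x y) -> (forall y, exists x, G x y) ->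
  (forall x y y', G x y -> G x y' -> y = y') ->
  (forall x x' y, G x y -> G x' y -> x = x') ->
  exists g : A -> B, bijective g /\ forall x, G x (g x).
Proof.
move=> totl totr funr funl.
pose g x := sval (constructive_indefinite_description _ (totl x)).
pose g' y := sval (constructive_indefinite_description _ (totr y)).
have gP x : G x (g x) by rewrite /g; case: constructive_indefinite_description.
have g'P y : G (g' y) y.
  by rewrite /g'; case: constructive_indefinite_description.
exists g; split=> //; exists g' => [x|y].
  exact: funl (g'P _) (gP _).
exact: funr (gP _) (g'P _).
Qed.

Theorem mainTheorem6 (F : finFieldType) (n : nat) (n_gt0 : (0 < n)%N)
  (V W : 'I_n -> finLmodType F)
  (E : forall i : 'I_n, V i -> F -> V (ordS i) -> Prop)
  (E' : forall i : 'I_n, W i -> F -> W (ordS i) -> Prop) :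
  linear_trellis E -> linear_trellis E' ->
  trim E -> trim E' ->
  reduced E -> reduced E' ->
  (exists f : forall i, V i -> W i, trellis_iso E E' f) ->
  exists g : forall i, V i -> W i, linear_trellis_iso E E' g.
Proof.
move=> linE linE' trimE trimE' redE redE' [f1 f1P].
have [f fP f0] := trellis_iso_pointed linE linE' f1P.
have [f' f'P fK] := trellis_iso_sym fP.
have f'0 i : f' i 0 = 0 by rewrite -(f0 i) fK.
have [D [j [r [j_lin jK]]]] := trellis_embedding V.
have [D' [j' [r' [j'_lin j'K]]]] := trellis_embedding W.
pose linR := embed_edges_lin j_lin linE.
pose linR' := embed_edges_lin j'_lin linE'.
have arcP i l :=
  transport_arc_space n_gt0 j_lin jK j'_lin j'K linE linE' fP f0 i l.
have arcP' i l :=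
  transport_arc_space n_gt0 j'_lin j'K j_lin jK linE' linE f'P f'0 i l.
have [cyc1 cyc2] := transport_cycle_space j_lin jK j'_lin j'K linE linE' fP.
have [cyc1' cyc2'] := transport_cycle_space j'_lin j'K j_lin jK linE' linE f'P.
(* The required equalities follow from the opposite inequalities supplied by [f] and its inverse
   [f']. *)
have [||||psi [[psi_inj psi_lab] im_psi im_arc]] :=
    @cycle_space_iso _ _ n_gt0 _ _ _ _ linR linR'.
- move=> i l; have [d _] := arcP i l; have [d' _] := arcP' i l.
  by apply/eqP; rewrite eqn_leq; apply/andP.
- move=> i l; have [_ d] := arcP i l; have [_ d'] := arcP' i l.
  by apply/eqP; rewrite eqEsubv; apply/andP.
- by apply/eqP; rewrite eqn_leq; apply/andP.
- by apply/eqP; rewrite eqEsubv; apply/andP.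
pose C := cycle_space linR; pose C' := cycle_space linR'.
have psi_injC x y : x \in C -> y \in C -> psi x = psi y -> x = y.
  move=> xC yC /eqP; rewrite -subr_eq0 -linearB -memv_ker => kxy.
  apply/eqP; rewrite -subr_eq0 -memv0 -psi_inj memv_cap kxy andbT.
  exact: rpredB.
have ordE (i : 'I_n) : cyc_ord n_gt0 i = i.
  by apply: val_inj; rewrite /= modn_small.
(* Apply [im_arc] to the difference of the two cycles. *)
have psi_vertex x y i : x \in C -> y \in C ->
    x.1 i = y.1 i <-> (psi x).1 i = (psi y).1 i.
  move=> xC yC; have xyC : x - y \in C by exact: rpredB.
  have sub0 M (u v : walk n M) : (u - v).1 i = 0 <-> u.1 i = v.1 i.
    by rewrite !ffunE; split=> [/eqP|->]; rewrite ?subrr // subr_eq0 => /eqP.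
  rewrite -sub0 -[_ = (psi y).1 i]sub0 -linearB.
  have key := arc_space_full n_gt0 linR i.
  have key' := arc_space_full n_gt0 linR' i.
  rewrite ordE in key key'.
  split=> [xy0|pxy0].
    have : x - y \in arc_space n_gt0 linR i n by apply/key.
    by move/(memv_img psi); rewrite im_arc // => /key'[].
  have : psi (x - y) \in arc_space n_gt0 linR' i n.
    by apply/key'; split=> //; rewrite -im_psi memv_img.
  rewrite -im_arc // => /memv_imgP[z /key[zC z0]].
  by move/(psi_injC _ _ xyC zC) ->.
have lab x i : x \in C -> (psi x).2 i = x.2 i.
  by move/psi_lab; rewrite !labelsE => ->.
(* Reducedness makes every edge visible in the cycle space. *)
have edgeC i u al w : E i u al w -> exists x, [/\ x \in C,
    x.1 i = j i u, x.2 i = al & x.1 (ordS i) = j (ordS i) w].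
  move=> /redE[v [a [va [<- [<- <-]]]]].
  exists ([ffun k => j k (v k)], [ffun k => a k] : {ffun 'I_n -> F^o}).
  split; rewrite ?ffunE //.
  by apply/cycle_spaceP; exact: closed_walk_of_cycle.
have edgeC' i u al w : E' i u al w -> exists x, [/\ x \in C,
    (psi x).1 i = j' i u, x.2 i = al & (psi x).1 (ordS i) = j' (ordS i) w].
  move=> /redE'[v [a [va [<- [<- <-]]]]].
  pose y : walk n 'rV[F]_D' :=
    ([ffun k => j' k (v k)], [ffun k => a k] : {ffun 'I_n -> F^o}).
  have : y \in C' by apply/cycle_spaceP; exact: closed_walk_of_cycle.
  rewrite /C' -im_psi => /memv_imgP[x xC def_y].
  by exists x; rewrite -(lab x i xC) -def_y !ffunE.
have vertexC x i : x \in C -> j i (r i (x.1 i)) = x.1 i.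
  by move/cycle_spaceP/(closed_walk_embed _ jK) => [->].
have vertexC' x i : x \in C -> j' i (r' i ((psi x).1 i)) = (psi x).1 i.
  move=> xC; have : psi x \in C' by rewrite /C' -im_psi memv_img.
  by move/cycle_spaceP/(closed_walk_embed _ j'K) => [->].
(* Vertices correspond when a cycle through one is sent by [psi] to a cycle through the other.
   Trimness and reducedness make [G] total on both sides, and [psi_vertex] makes it single-valued
   both ways. *)
pose G i (u : V i) (w : W i) :=
  exists x, [/\ x \in C, x.1 i = j i u & (psi x).1 i = j' i w].
have Gtot i u : exists w, G i u w.
  have [al [w /edgeC[x [xC xu _ _]]]] := proj1 trimE i u.
  by exists (r' i ((psi x).1 i)), x; rewrite vertexC'.
have Gtot' i w : exists u, G i u w.
  have [al [w' /edgeC'[x [xC xu _ _]]]] := proj1 trimE' i w.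
  by exists (r i (x.1 i)), x; rewrite vertexC.
have Gfun i u w w' : G i u w -> G i u w' -> w = w'.
  move=> [x [xC xu xw]] [y [yC yu yw]]; apply: (can_inj (@j'K i)).
  by rewrite -xw -yw; apply/psi_vertex; rewrite ?xu.
have Gfun' i u u' w : G i u w -> G i u' w -> u = u'.
  move=> [x [xC xu xw]] [y [yC yu yw]]; apply: (can_inj (@jK i)).
  by rewrite -xu -yu; apply/psi_vertex; rewrite ?xw.
pose bij i := constructive_indefinite_description _
  (bijection_of_relation (@Gtot i) (@Gtot' i) (@Gfun i) (@Gfun' i)).
pose g i := sval (bij i).
have [g_bij gG] : (forall i, bijective (g i)) /\ (forall i u, G i u (g i u)).
  by split=> i; case: (svalP (bij i)).
exists g; split; first split=> // i u al w.
  (* A cycle through the given edge and its partner under [psi] have the same label at [i], and [G]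
     relates their vertices. *)
  split=> [/edgeC[x [xC xu xa xw]]|/edgeC'[x [xC xu xa xw]]].
    have : closed_walk (embed_edges E' j') (psi x).
      by apply/(cycle_spaceP linR'); rewrite -im_psi memv_img.
    move/(closed_walk_embed _ j'K) => [_ /(_ i)]; rewrite lab // xa.
    have Gi : G i u (r' i ((psi x).1 i)) by exists x; rewrite vertexC'.
    have Gs : G (ordS i) w (r' (ordS i) ((psi x).1 (ordS i))).
      by exists x; rewrite vertexC'.
    by rewrite (Gfun _ _ _ _ Gi (gG i u)) (Gfun _ _ _ _ Gs (gG _ w)).
  have /cycle_spaceP/(closed_walk_embed _ jK)[_ /(_ i)] := xC; rewrite xa.
  have Gi : G i (r i (x.1 i)) (g i u) by exists x; rewrite vertexC.
  have Gs : G (ordS i) (r (ordS i) (x.1 (ordS i))) (g (ordS i) w).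
    by exists x; rewrite vertexC.
  by rewrite (Gfun' _ _ _ _ Gi (gG i u)) (Gfun' _ _ _ _ Gs (gG _ w)).
(* [G] is closed under linear combinations because [psi] and the embeddings are linear; uniqueness
   then makes [g] linear. *)
move=> i c u w; apply: (Gfun _ _ _ _ (gG _ _)).
have [x [xC xu xg]] := gG i u; have [y [yC yw yg]] := gG i w.
exists (c *: x + y); split; first by rewrite memvD ?memvZ.
  by rewrite !ffunE xu yw j_lin.
by rewrite linearP !ffunE xg yg j'_lin.
Qed.
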